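(* A graph $G$ is a König-Egerváry graph with two disjoint maximum independent sets if and only if $G$ is a bipartite graph having a perfect matching.
   Context: All graphs are finite, undirected, without loops or multiple edges. $n(G)$ is the number of vertices of $G$, $\alpha(G)$ is the maximum size of an independent set, and $\mu(G)$ is the size of a largest matching. A maximum independent set is an independent set of size $\alpha(G)$. $G$ is a König-Egerváry graph if $\alpha(G)+\mu(G)=n(G)$. *)

(* Defs.v *)
From mathcomp Require Import all_boot.

Set Implicit Arguments.
Unset Strict Implicit.
Unset Printing Implicit Defensive.

(* A simple graph is a finite type of vertices T together with an adjacency
   relation e : rel T, assumed symmetric and irreflexive where it matters. *)
Section Graph.

Variables (T : finType) (e : rel T).

Definition edges : {set {set T}} := [set [set x; y] | x in T, y in T & e x y].

Definition independent (A : {set T}) : bool :=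
  [forall x in A, forall y in A, ~~ e x y].

Definition alpha : nat := \max_(A : {set T} | independent A) #|A|.

Definition max_independent (A : {set T}) : bool :=
  independent A && (#|A| == alpha).

Definition matching (M : {set {set T}}) : bool :=
  (M \subset edges) && trivIset M.

Definition mu : nat := \max_(M : {set {set T}} | matching M) #|M|.

Definition perfect_matching (M : {set {set T}}) : bool :=
  matching M && (cover M == [set: T]).

Definition konig_egervary : Prop := alpha + mu = #|T|.

(* The two classes of a bipartition may be empty. *)
Definition bipartite : Prop :=
  exists A B : {set T},
    [/\ A :|: B = [set: T], [disjoint A & B], independent A & independent B].

End Graph.

(* Main.v *)
Require Import Defs.
From mathcomp Require Import all_boot.

Set Implicit Arguments.
Unset Strict Implicit.
Unset Printing Implicit Defensive.

(** A matching M covers 2|M| vertices, so 2 mu <= n, while two disjoint maximum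
    independent sets give 2 alpha <= n; with alpha + mu = n both are equalities,
    so the two sets form a bipartition and every maximum matching is perfect.
    Conversely, an independent set meets each edge of a perfect matching M at
    most once, so alpha <= |M| = n/2, and both sides of a bipartition attain
    this bound. *)

Section Matching.

Context {T : finType} {e : rel T}.

Lemma edgesP (b : {set T}) :
  reflect (exists x y, e x y /\ b = [set x; y]) (b \in edges e).
Proof.
apply: (iffP imset2P) => [[x y _ + ->]|[x [y [exy ->]]]].
  by rewrite inE => /andP[_ exy]; exists x, y.
by exists x y; rewrite ?inE.
Qed.

Lemma independentP (A : {set T}) :
  reflect {in A &, forall x y, ~~ e x y} (independent e A).
Proof.
apply: (iffP forall_inP) => [indA x y xA yA|indA x xA].
  exact: (forall_inP (indA x xA)).
by apply/forall_inP => y yA; apply: indA.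
Qed.

Lemma card_edge (e_irr : irreflexive e) (b : {set T}) :
  b \in edges e -> #|b| = 2.
Proof.
case/edgesP => x [y [exy ->]]; rewrite cards2.
by case: eqVneq exy => // ->; rewrite e_irr.
Qed.

(** The edges of [M] are pairwise disjoint, and each has two distinct ends. *)
Lemma card_cover_matching (e_irr : irreflexive e) (M : {set {set T}}) :
  matching e M -> #|cover M| = #|M|.*2.
Proof.
case/andP => /subsetP sME /eqP <-.
rewrite (eq_bigr (fun=> 2)) => [|b /sME/(card_edge e_irr) //].
by rewrite sum_nat_const muln2.
Qed.

(** Two distinct common vertices would be the adjacent ends of [b]. *)
Lemma card_independentI_edge (e_sym : symmetric e) (A b : {set T}) :
  independent e A -> b \in edges e -> #|A :&: b| <= 1.
Proof.
move=> /independentP indA /edgesP[x [y [exy ->]]].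
apply/card_le1_eqP => u v; rewrite !inE => /andP[uA ub] /andP[vA vb].
by case/pred2P: ub uA vb vA => -> uA /pred2P[] -> vA //;
  have := indA _ _ uA vA; rewrite ?exy // e_sym exy.
Qed.

(** [A] is the union of its traces on the edges of [M], each of at most one vertex. *)
Lemma card_independent_cover (e_sym : symmetric e) (A : {set T})
    (M : {set {set T}}) :
  independent e A -> matching e M -> A \subset cover M -> #|A| <= #|M|.
Proof.
move=> indA /andP[/subsetP sME _] /setIidPl <-.
rewrite /cover big_distrr /= -sum1_card.
apply: (@leq_trans (\sum_(b in M) #|A :&: b|)).
  rewrite sum1_card; elim/big_rec2: _ => [|b m B _ leBm]; first by rewrite cards0.
  by rewrite (leq_trans (leq_card_setU _ _)) // leq_add2l.
by rewrite -[#|M|]sum1_card leq_sum // => b /sME; apply: card_independentI_edge.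
Qed.

(** The empty matching makes the family nonempty, so the maximum is attained. *)
Lemma exists_maximum_matching : exists2 M, matching e M & #|M| = mu e.
Proof.
have match0 : matching e set0.
  by rewrite /matching sub0set; apply/trivIsetP => b c; rewrite inE.
have [M matM muE] := eq_bigmax_cond (fun M : {set {set T}} => #|M|)
  (introT card_gt0P (ex_intro [in matching e] set0 match0)).
by exists M => //; rewrite /mu -muE.
Qed.

End Matching.

Theorem theorem3p1 (T : finType) (e : rel T)
    (e_sym : symmetric e) (e_irr : irreflexive e) :
  (konig_egervary e /\
   exists A B : {set T},
     [/\ max_independent e A, max_independent e B & [disjoint A & B]])
  <->
  (bipartite e /\ exists M : {set {set T}}, perfect_matching e M).
Proof.
have [N matN muE] := @exists_maximum_matching T e.
have cardN := card_cover_matching e_irr matN.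
have le_mu : (mu e).*2 <= #|T| by rewrite -muE -cardN max_card.
split=> [[ke [A [B [/andP[indA /eqP cA] /andP[indB /eqP cB] disjAB]]]]|].
  have cardAB : #|A :|: B| = (alpha e).*2.
    (* The equality case of the union bound is exactly disjointness. *)
    move: (leq_card_setU A B) => [_]; rewrite disjAB => /eqP ->.
    by rewrite cA cB addnn.
  have le_alpha : (alpha e).*2 <= #|T| by rewrite -cardAB max_card.
  have dT : (alpha e).*2 + (mu e).*2 = #|T|.*2 by rewrite -doubleD ke.
  split.
    exists A, B; split => //; apply/eqP.
    (* Adding [(mu e).*2] to both sides reduces [#|T| <= (alpha e).*2] to [le_mu]. *)
    rewrite eqEcard subsetT cardsT cardAB -(leq_add2r (mu e).*2) dT -(addnn #|T|).
    by rewrite leq_add2l.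
  exists N; rewrite /perfect_matching matN eqEcard subsetT cardsT cardN muE /=.
  (* Symmetrically, [#|T| <= (mu e).*2] reduces to [le_alpha]. *)
  by rewrite -(leq_add2l (alpha e).*2) dT -(addnn #|T|) leq_add2r.
case=> [[A [B [ABT disjAB indA indB]]] [M /andP[matM /eqP covM]]].
have cardM := card_cover_matching e_irr matM; rewrite covM cardsT in cardM.
have le_ind (S : {set T}) : independent e S -> #|S| <= #|M|.
  by move=> indS; apply: (card_independent_cover e_sym indS matM);
    rewrite covM subsetT.
have cardAB : #|A| + #|B| = #|M| + #|M|.
  move: (leq_card_setU A B) => [_]; rewrite disjAB ABT cardsT => /eqP <-.
  by rewrite cardM addnn.
have cA : #|A| = #|M|.
  (* The sum in [cardAB] forces [#|M| <= #|A|], because [#|B| <= #|M|]. *)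
  apply/eqP; rewrite eqn_leq le_ind //= -(leq_add2r #|M|) -cardAB leq_add2l.
  exact: le_ind.
have cB : #|B| = #|M| by move/eqP: cardAB; rewrite cA eqn_add2l => /eqP.
have alphaE : alpha e = #|M|.
  apply/eqP; rewrite eqn_leq; apply/andP; split; first exact/bigmax_leqP.
  by rewrite -cA; apply: (bigmax_sup A).
have muM : mu e = #|M|.
  (* The upper bound is [le_mu], since [#|T|] is twice [#|M|]. *)
  apply/eqP; rewrite eqn_leq -leq_double -cardM le_mu /=.
  exact: (bigmax_sup M).
split; first by rewrite /konig_egervary alphaE muM addnn cardM.
by exists A, B; rewrite /max_independent indA indB cA cB alphaE eqxx.
Qed.
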